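(* Let $E,Q,E_1,Q_1\in M_n(\mathbb C)$ and let $E$ or $Q$ be a nonsingular matrix. Then the following statements are equivalent: (a) $(E,Q)$ is $^T$-equivalent (respectively, $^*$-equivalent) to $(E_1,Q_1)$. (b) $E^TQ$ (respectively, $E^*Q$) is $^T$-congruent (respectively, $^*$-congruent) to $E_1^TQ_1$ (respectively, $E_1^*Q_1$). (c) $EQ^{-1}$ is $^T$-congruent (respectively, $^*$-congruent) to $E_1Q_1^{-1}$, provided that $Q$ is nonsingular.
   Context: $M_n(\mathbb C)$ is the set of $n\times n$ complex matrices and $GL_n(\mathbb C)$ the set of nonsingular ones. $A^*$ is the conjugate transpose, $A^{-T}=(A^{-1})^T$, $A^{-*}=(A^{-1})^*$. A pair $(E,Q)$ is $^T$-equivalent (respectively, $^*$-equivalent) to $(E_1,Q_1)$ if there exist $U,V\in GL_n(\mathbb C)$ with $(E_1,Q_1)=(UEV,U^{-T}QV)$ (respectively, $(E_1,Q_1)=(UEV,U^{-*}QV)$). Matrices $A,B\in M_n(\mathbb C)$ are $^T$-congruent (respectively, $^*$-congruent) if there is $S\in GL_n(\mathbb C)$ with $S^TAS=B$ (respectively, $S^*AS=B$).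
   Formalization: (b)⇒(a) and (b)⇒(c) also assume that E,Q, or E,E1, or Q,Q1 are both nonsingular: for E=I, Q=0, E1=0, Q1=I, (b) holds but (a) fails. Statement (c) is read as including that Q1 is nonsingular. *)

(* Defs.v *)
From HB Require Import structures.
From mathcomp Require Import all_boot all_order all_algebra.
From mathcomp Require Import reals.
From mathcomp Require Export complex.

Set Implicit Arguments.
Unset Strict Implicit.
Unset Printing Implicit Defensive.

Import Order.TTheory GRing.Theory Num.Theory.
Local Open Scope ring_scope.
Local Open Scope sesquilinear_scope.

(* The complex numbers are R[i] over a realType R; "A ^t*" is the conjugate
   transpose. *)

Definition T_equivalent (R : realType) (n : nat) (E Q E1 Q1 : 'M[R[i]]_n) : Prop :=
  exists U V : 'M[R[i]]_n, [/\ U \in unitmx, V \in unitmx,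
    E1 = U *m E *m V & Q1 = (invmx U)^T *m Q *m V].

Definition star_equivalent (R : realType) (n : nat) (E Q E1 Q1 : 'M[R[i]]_n) : Prop :=
  exists U V : 'M[R[i]]_n, [/\ U \in unitmx, V \in unitmx,
    E1 = U *m E *m V & Q1 = (invmx U) ^t* *m Q *m V].

Definition T_congruent (R : realType) (n : nat) (A B : 'M[R[i]]_n) : Prop :=
  exists2 S : 'M[R[i]]_n, S \in unitmx & S^T *m A *m S = B.

Definition star_congruent (R : realType) (n : nat) (A B : 'M[R[i]]_n) : Prop :=
  exists2 S : 'M[R[i]]_n, S \in unitmx & S ^t* *m A *m S = B.

(* Nonsingularity of E or Q has to be matched in the second pair: for n > 0,
   the pairs (1, 0) and (0, 1) have E^T Q = 0 = E1^T Q1 but are not equivalent.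
   No assumption on (E1, Q1) is made when both E and Q are nonsingular. *)
Definition matching_nonsingular (R : realType) (n : nat)
    (E Q E1 Q1 : 'M[R[i]]_n) : Prop :=
  [\/ E \in unitmx /\ Q \in unitmx,
      E \in unitmx /\ E1 \in unitmx
    | Q \in unitmx /\ Q1 \in unitmx].

(* Main.v *)
(** Both halves are the same argument for an involutive anti-automorphism [t]
    of the matrix algebra. With [E1 = U E V] and [Q1 = t(U)^-1 Q V] one gets
    [t(E1) Q1 = t(V) (t(E) Q) V] and [E1 Q1^-1 = U (E Q^-1) t(U)]. Conversely a
    congruence supplies [V] in the first case and [U] in the second one, and the
    other factor is forced by whichever matrices are nonsingular. *)
Require Import Defs.
From mathcomp Require Import all_boot all_order all_algebra.
From mathcomp Require Import reals.

Local Open Scope ring_scope.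
Local Open Scope sesquilinear_scope.

Section InvolutionEquivalence.

Variables (F : comUnitRingType) (n : nat) (t : 'M[F]_n -> 'M[F]_n).
Hypotheses (tM : forall A B, t (A *m B) = t B *m t A) (tK : involutive t).

Implicit Types E Q U V S A B : 'M[F]_n.

Definition inv_equivalent E Q E1 Q1 : Prop :=
  exists U V, [/\ U \in unitmx, V \in unitmx,
    E1 = U *m E *m V & Q1 = t (invmx U) *m Q *m V].

Definition inv_congruent A B : Prop :=
  exists2 S, S \in unitmx & t S *m A *m S = B.

(** Writing the identity as [t (t 1)] turns [t 1 *m 1] into [t (t 1 *m 1)], which is again
    [t (t 1)]. *)
Lemma involution1 : t 1%:M = 1%:M.
Proof. by rewrite -[LHS]mulmx1 -{2}(tK 1%:M) -tM mulmx1 tK. Qed.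

Lemma involution_mulmxV A : A \in unitmx -> t A *m t (invmx A) = 1%:M.
Proof. by move=> uA; rewrite -tM mulVmx ?involution1. Qed.

Lemma involution_mulVmx A : A \in unitmx -> t (invmx A) *m t A = 1%:M.
Proof. by move=> uA; rewrite -tM mulmxV ?involution1. Qed.

Lemma unitmx_involution A : A \in unitmx -> t A \in unitmx.
Proof. by move=> /involution_mulmxV/mulmx1_unit[]. Qed.

Lemma involution_invmx A : A \in unitmx -> t (invmx A) = invmx (t A).
Proof.
move=> uA; rewrite -[LHS](mulKmx (unitmx_involution _ uA)).
by rewrite involution_mulmxV // mulmx1.
Qed.

Lemma inv_equivalent_congruent E Q E1 Q1 :
  inv_equivalent E Q E1 Q1 -> inv_congruent (t E *m Q) (t E1 *m Q1).
Proof.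
case=> U [V [uU uV -> ->]]; exists V => //.
by rewrite !tM -!mulmxA (mulmxA (t U)) involution_mulmxV ?mul1mx.
Qed.

Lemma inv_congruent_equivalentl E Q E1 Q1 :
    E \in unitmx -> E1 \in unitmx ->
  inv_congruent (t E *m Q) (t E1 *m Q1) -> inv_equivalent E Q E1 Q1.
Proof.
(* With [V = S], the equation [E1 = U *m E *m S] forces [U] to be the inverse of [W]. *)
move=> uE uE1 [S uS eS]; set W := E *m S *m invmx E1.
have uW : W \in unitmx by rewrite !unitmx_mul unitmx_inv uE uS.
exists (invmx W), S; split; rewrite ?unitmx_inv //.
  by rewrite -mulmxA -[E *m S](mulmxKV uE1) mulKmx.
rewrite invmxK !tM -!mulmxA; move: eS; rewrite -!mulmxA => ->.
by rewrite mulmxA involution_mulVmx ?mul1mx.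
Qed.

Lemma inv_congruent_equivalentr E Q E1 Q1 :
    Q \in unitmx -> Q1 \in unitmx ->
  inv_congruent (t E *m Q) (t E1 *m Q1) -> inv_equivalent E Q E1 Q1.
Proof.
move=> uQ uQ1 [S uS eS].
(* Applying [t] to the congruence frees [E1], so that cancelling [t Q1] will express it through
   [E]. *)
have eS' : t Q1 *m E1 = t S *m t Q *m E *m S.
  by rewrite -[LHS]tK tM tK -eS !tM !tK !mulmxA.
(* With [V = S], the equation for [Q1] forces [t U = W], hence [U = t W]. *)
set W := Q *m S *m invmx Q1.
have uW : W \in unitmx by rewrite !unitmx_mul unitmx_inv uQ uS.
exists (t W), S; split; rewrite ?unitmx_involution //.
  rewrite !tM -!mulmxA; move: eS'; rewrite -!mulmxA => <-.
  by rewrite mulmxA involution_mulVmx ?mul1mx.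
rewrite involution_invmx ?unitmx_involution // tK.
by rewrite -mulmxA -[Q *m S](mulmxKV uQ1) mulKmx.
Qed.

Lemma inv_congruent_equivalent E Q E1 Q1 :
    [\/ E \in unitmx /\ Q \in unitmx, E \in unitmx /\ E1 \in unitmx
      | Q \in unitmx /\ Q1 \in unitmx] ->
  inv_congruent (t E *m Q) (t E1 *m Q1) -> inv_equivalent E Q E1 Q1.
Proof.
case=> -[u1 u2] cS; last 2 first.
- exact: inv_congruent_equivalentl.
- exact: inv_congruent_equivalentr.
(* When [E] and [Q] are both invertible, the congruence makes [t E1 *m Q1] invertible, and so its
   factor [Q1]. *)
apply: inv_congruent_equivalentr => //; case: cS => S uS eS.
have: t E1 *m Q1 \in unitmx.
  by rewrite -eS !unitmx_mul !unitmx_involution // u2 uS.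
by rewrite unitmx_mul => /andP[].
Qed.

(** [invmx] fixes singular matrices, so the congruence speaks of a true inverse of [Q1] only
    together with [Q1 \in unitmx]. *)
Lemma inv_equivalentP E Q E1 Q1 : Q \in unitmx ->
  inv_equivalent E Q E1 Q1 <->
  Q1 \in unitmx /\ inv_congruent (E *m invmx Q) (E1 *m invmx Q1).
Proof.
move=> uQ; split=> [[U [V [uU uV -> eQ1]]]|[uQ1 [S uS eS]]].
  have uQ1 : Q1 \in unitmx.
    by rewrite eQ1 !unitmx_mul unitmx_involution ?unitmx_inv // uQ uV.
  split=> //; exists (t U); rewrite ?unitmx_involution // tK.
  (* Solving the second equation for [V] eliminates it from [E1 *m invmx Q1]. *)
  have eV : V = invmx Q *m t U *m Q1.
    by rewrite eQ1 -!mulmxA (mulmxA (t U)) involution_mulmxV // mul1mx mulKmx.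
  by rewrite [in RHS]eV !mulmxA mulmxK.
(* Here [U = t S], and [V] is again the solution of the equation for [Q1]. *)
exists (t S), (invmx Q *m S *m Q1); split.
- exact: unitmx_involution.
- by rewrite !unitmx_mul unitmx_inv uQ uS.
- by rewrite -[LHS](mulmxKV uQ1) -eS !mulmxA.
- by rewrite involution_invmx ?unitmx_involution // tK !mulmxA mulmxK // mulVmx ?mul1mx.
Qed.

End InvolutionEquivalence.

Theorem lemma3p1 (R : realType) (n : nat) (E Q E1 Q1 : 'M[R[i]]_n)
    (hEQ : E \in unitmx \/ Q \in unitmx) :
  [/\ T_equivalent E Q E1 Q1 -> T_congruent (E^T *m Q) (E1^T *m Q1),
      matching_nonsingular E Q E1 Q1 ->
        T_congruent (E^T *m Q) (E1^T *m Q1) -> T_equivalent E Q E1 Q1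
    & Q \in unitmx ->
        (T_equivalent E Q E1 Q1 <->
         Q1 \in unitmx /\ T_congruent (E *m invmx Q) (E1 *m invmx Q1))]
  /\
  [/\ star_equivalent E Q E1 Q1 ->
        star_congruent (E ^t* *m Q) (E1 ^t* *m Q1),
      matching_nonsingular E Q E1 Q1 ->
        star_congruent (E ^t* *m Q) (E1 ^t* *m Q1) -> star_equivalent E Q E1 Q1
    & Q \in unitmx ->
        (star_equivalent E Q E1 Q1 <->
         Q1 \in unitmx /\ star_congruent (E *m invmx Q) (E1 *m invmx Q1))].
Proof.
have TM (A B : 'M[R[i]]_n) : (A *m B)^T = B^T *m A^T by exact: trmx_mul.
have TK : involutive (fun A : 'M[R[i]]_n => A^T) by exact: trmxK.
have sM (A B : 'M[R[i]]_n) : (A *m B) ^t* = B ^t* *m A ^t*.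
  by rewrite trmx_mul map_mxM.
have sK : involutive (fun A : 'M[R[i]]_n => A ^t*).
  by move=> A; apply/matrixP=> i j; rewrite !mxE Num.Theory.conjCK.
split; split.
(* The concrete relations unfold to [inv_equivalent] and [inv_congruent], with [t] the transpose and
   then the conjugate transpose. *)
- exact: (inv_equivalent_congruent _ _ _ TM TK).
- exact: (inv_congruent_equivalent _ _ _ TM TK).
- exact: (inv_equivalentP _ _ _ TM TK).
- exact: (inv_equivalent_congruent _ _ _ sM sK).
- exact: (inv_congruent_equivalent _ _ _ sM sK).
- exact: (inv_equivalentP _ _ _ sM sK).
Qed.
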